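(* Let $K$ be a field, let $G$ be a finite simple graph and let $k$ be an integer with $2\leq k\leq \nu(G)$. If $G$ has a dominating clique $K_{2k-1}$ (i.e. a complete subgraph on $2k-1$ vertices whose vertex set is a dominating set of $G$), then $g_{I(G)}(k)=0$.
   Context: Let $G$ have vertex set $\{1,\ldots,n\}$ and let $S=K[x_1,\ldots,x_n]$. A set $D$ of vertices of $G$ is a dominating set if every vertex of $G$ not in $D$ is adjacent to some vertex in $D$. The edge ideal $I(G)\subset S$ is generated by all $x_ix_j$ with $\{i,j\}$ an edge of $G$. A $k$-matching is a set of $k$ pairwise disjoint edges, and $\nu(G)$ is the maximum size of a matching of $G$. The $k$-th squarefree power $I(G)^{[k]}$ is the ideal generated by the squarefree monomials $x_{i_1}x_{j_1}\cdots x_{i_k}x_{j_k}$ where $\{i_1,j_1\},\ldots,\{i_k,j_k\}$ is a $k$-matching of $G$. For $1\le k\le \nu(G)$, $g_{I(G)}(k)=\operatorname{depth}(S/I(G)^{[k]})-(2k-1)$. *)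

(* Defs.v *)
From mathcomp Require Import all_boot all_order all_algebra.
From mathcomp Require Import mpoly.
From Stdlib Require Import ClassicalEpsilon.

Set Implicit Arguments.
Unset Strict Implicit.
Unset Printing Implicit Defensive.

Import GRing.Theory.
Local Open Scope ring_scope.

(* A simple graph on the vertex set {1, ..., n} is given by its adjacency      *)
(* relation e : rel 'I_n, assumed symmetric and irreflexive.                   *)

Section Graphs.
Variables (n : nat) (e : rel 'I_n).

Definition edges : {set {set 'I_n}} :=
  [set A | [exists i, exists j, e i j && (A == [set i; j])]].

Definition is_matching (M : {set {set 'I_n}}) : bool :=
  (M \subset edges) && trivIset M.

Definition matching_number : nat := \max_(M | is_matching M) #|M|.

Definition is_clique (D : {set 'I_n}) : Prop :=
  forall u v, u \in D -> v \in D -> u != v -> e u v.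

Definition is_dominating (D : {set 'I_n}) : Prop :=
  forall v, v \notin D -> exists2 u, u \in D & e v u.

End Graphs.

Section Depth.
Variables (K : fieldType) (n : nat).
Local Notation S := {mpoly K[n]}.

(* Ideals of S are represented by their membership predicates. *)
Definition ideal_gen (P : S -> Prop) (f : S) : Prop :=
  exists s : seq (S * S),
    (forall p, p \in s -> P p.2) /\ f = \sum_(p <- s) p.1 * p.2.

Definition irrelevant_ideal : S -> Prop :=
  ideal_gen (fun f => exists i : 'I_n, f = 'X_i).

(* The ideal I + (fs) of S, for an ideal I. *)
Definition ideal_add_seq (I : S -> Prop) (fs : seq S) : S -> Prop :=
  ideal_gen (fun f => I f \/ f \in fs).

(* f is a nonzerodivisor on the S-module S / J. *)
Definition regular_on_quotient (J : S -> Prop) (f : S) : Prop :=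
  forall h : S, J (f * h) -> J h.

(* fs is an (S / I)-regular sequence; the second condition says that           *)
(* (S / I) / (fs) (S / I) is nonzero.                                          *)
Definition regular_sequence (I : S -> Prop) (fs : seq S) : Prop :=
  (forall i, (i < size fs)%N ->
     regular_on_quotient (ideal_add_seq I (take i fs)) (nth 0 fs i)) /\
  ~ ideal_add_seq I fs 1.

(* depth (S / I) = d, for the depth with respect to the graded maximal ideal:  *)
(* d is the largest length of an (S / I)-regular sequence of elements of       *)
(* (x_1, ..., x_n).                                                            *)
Definition is_depth_quotient (I : S -> Prop) (d : nat) : Prop :=
  (exists fs : seq S, [/\ size fs = d,
     forall f, f \in fs -> irrelevant_ideal f & regular_sequence I fs]) /\
  (forall fs : seq S, (forall f, f \in fs -> irrelevant_ideal f) ->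
     regular_sequence I fs -> (size fs <= d)%N).

(* Unspecified when no such d exists, e.g. for I = S. *)
Definition depth_quotient (I : S -> Prop) : nat :=
  epsilon (inhabits 0%N) (is_depth_quotient I).

End Depth.

Section SquarefreePowers.
Variables (K : fieldType) (n : nat) (e : rel 'I_n).

Definition squarefree_power (k : nat) : {mpoly K[n]} -> Prop :=
  ideal_gen (fun f => exists M : {set {set 'I_n}},
    [/\ is_matching e M, #|M| = k &
        f = \prod_(A in M) \prod_(i in A) 'X_i]).

(* The normalized depth function g_{I(G)}, meaningful for 1 <= k <= nu(G). *)
Definition normalized_depth (k : nat) : int :=
  (depth_quotient (squarefree_power k))%:Z - (2 * k%:Z - 1).

End SquarefreePowers.

Arguments squarefree_power K {n} e k.
Arguments normalized_depth K {n} e k.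

(* Main.v *)
Require Import Defs.
From Stdlib Require Import ClassicalEpsilon.
From mathcomp Require Import mpoly.
From mathcomp Require Import all_boot all_order all_algebra ring zify.

Set Implicit Arguments.
Unset Strict Implicit.
Unset Printing Implicit Defensive.

(** Write t = 2k - 1 = #|D| and let I be the k-th squarefree power.  It is
spanned by the monomials whose support contains the vertices of a k-matching,
so the theorem is an instance of [mon_ideal_depth]: if I is the
Stanley-Reisner ideal of a simplicial complex in which every set of at most t
vertices is a face, and D is a facet with t vertices, then S / I has depth t.
Every set of t vertices is a face since a k-matching covers 2k > t vertices.
The clique D is a facet since a vertex v outside D is adjacent to some u in D,
and the clique D minus u has a perfect matching, which the edge vu completes
to a k-matching.

Depth at most t ([regular_length_le]).  The classical reason is that the prime
(x_v : v not in D) = (I : x_D) is associated to S / I and has dimension t.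
Associated primes and Krull dimension are avoided as follows.  A sequence fs
of more than t elements has algebraically dependent restrictions to the t
variables of D: some nonzero polynomial Q satisfies that every monomial of
q = Q(fs) has a variable outside D ([algebraic_dependence], by counting
monomials).  Hence q * x_D lies in I.  If fs is regular modulo I then q can be
cancelled up to powers of (fs) ([nonzero_value_cancel]), a consequence of the
fact that regular sequences are quasi-regular ([regular_add_ipow]); so x_D
lies in I + (fs)^N for all N.  When the constant terms of fs vanish, this
makes the degree of x_D at least N, which is absurd for N > t.

Depth at least t ([esyms_regular]).  The elementary symmetric polynomials
e_1, ..., e_t form a regular sequence modulo I over every field.  Regularity
modulo I follows from regularity modulo I + (x_i) and modulo (I : x_i)
([weakly_regular_extension]).  Repeatedly deleting vertices (set Z) and
passing to links (set U) reduces to the ideals (x_z : z in Z) with at least t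
variables left ([esyms_regular_link]).  In a polynomial ring in m variables
e_1, ..., e_m is a regular sequence by induction on m
([esyms_regular_vars]): e_1, ..., e_(m-1) is regular modulo any variable x_i,
so by homogeneity it is regular and x_i is regular modulo it
([graded_regular_lift]), and e_m is the product of the x_i. *)

(** * Ideals and regular sequences in a commutative ring *)

Section Ideals.
Import GRing.Theory.
Local Open Scope ring_scope.
Variable R : comNzRingType.
Implicit Types (J : R -> Prop) (f g h x y z : R) (fs : seq R).

Record is_ideal J : Prop := IsIdeal {
  ideal0 : J 0;
  idealD : forall x y, J x -> J y -> J (x + y);
  idealM : forall a x, J x -> J (a * x) }.

Lemma idealN J x : is_ideal J -> J x -> J (- x).
Proof. by move=> hJ Jx; rewrite -mulN1r; apply: idealM. Qed.

Lemma idealB J x y : is_ideal J -> J x -> J y -> J (x - y).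
Proof. by move=> hJ Jx Jy; apply: idealD => //; apply: idealN. Qed.

Definition adjoin J f : R -> Prop := fun g => exists a, J (g - a * f).

Definition colon J u : R -> Prop := fun g => J (u * g).

Definition regular_mod J f : Prop := forall h, J (f * h) -> J h.

(** Regular sequences up to the condition that the last quotient is nonzero.
The recursion passes to the quotient by the first element, so that an
induction on the sequence changes J and keeps R. *)
Fixpoint weakly_regular J fs : Prop :=
  if fs is f :: fs' then regular_mod J f /\ weakly_regular (adjoin J f) fs'
  else True.

Definition adjoin_seq J fs : R -> Prop := foldl adjoin J fs.

Lemma adjoin_ideal J f : is_ideal J -> is_ideal (adjoin J f).
Proof.
move=> hJ; split.
- by exists 0; rewrite mul0r subr0; apply: ideal0.
- move=> x y [a Ja] [b Jb]; exists (a + b).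
  have -> : x + y - (a + b) * f = (x - a * f) + (y - b * f) by ring.
  by apply: idealD.
- move=> c x [a Ja]; exists (c * a).
  have -> : c * x - c * a * f = c * (x - a * f) by ring.
  by apply: idealM.
Qed.

Lemma adjoin_seq_ideal J fs : is_ideal J -> is_ideal (adjoin_seq J fs).
Proof. by elim: fs J => //= f fs IH J hJ; apply/IH/adjoin_ideal. Qed.

Lemma sub_adjoin J f x : J x -> adjoin J f x.
Proof. by exists 0; rewrite mul0r subr0. Qed.

Lemma adjoin_mem J f a : is_ideal J -> adjoin J f (a * f).
Proof. by move=> hJ; exists a; rewrite subrr; apply: ideal0. Qed.

Lemma adjoin_mono J J' f : (forall x, J x -> J' x) ->
  forall x, adjoin J f x -> adjoin J' f x.
Proof. by move=> s x [a /s Ja]; exists a. Qed.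

Lemma adjoin_iff J J' f : (forall x, J x <-> J' x) ->
  forall x, adjoin J f x <-> adjoin J' f x.
Proof. by move=> e x; split; apply: adjoin_mono => y /e. Qed.

Lemma adjoin_swap J f g x : adjoin (adjoin J f) g x -> adjoin (adjoin J g) f x.
Proof.
move=> [a [b Jb]]; exists b, a.
by have -> : x - b * f - a * g = x - a * g - b * f by ring.
Qed.

Lemma weakly_regular_iff J J' fs : (forall x, J x <-> J' x) ->
  weakly_regular J fs -> weakly_regular J' fs.
Proof.
elim: fs J J' => //= f fs IH J J' e [r rs]; split.
  by move=> h /e /r /e.
exact: IH (adjoin_iff _ e) rs.
Qed.

Lemma adjoin_seq_iff J J' fs : (forall x, J x <-> J' x) ->
  forall x, adjoin_seq J fs x <-> adjoin_seq J' fs x.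
Proof. by elim: fs J J' => //= f fs IH J J' e; apply/IH/adjoin_iff. Qed.

Lemma weakly_regular_rcons J fs g :
  weakly_regular J (rcons fs g) <->
  weakly_regular J fs /\ regular_mod (adjoin_seq J fs) g.
Proof.
elim: fs J => [|f fs IH] J /=; first by split=> [[]|[]].
rewrite IH; split=> [[? [? ?]]|[[? ?] ?]] //; split=> //.
Qed.

Lemma weakly_regular_cat J fs gs :
  weakly_regular J (fs ++ gs) <->
  weakly_regular J fs /\ weakly_regular (adjoin_seq J fs) gs.
Proof.
elim: fs J => [|f fs IH] J /=; first by split=> [?|[]].
rewrite IH; split=> [[? [? ?]]|[[? ?] ?]] //; split=> //.
Qed.

(** The d-th power of the ideal generated by fs. Closure under multiplication
by ring elements is derived in [ipow_ideal] from that of the degree 0 part. *)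
Inductive ipow fs : nat -> R -> Prop :=
| ipow_all x : ipow fs 0 x
| ipow_0 d : ipow fs d 0
| ipow_mul d f x : f \in fs -> ipow fs d x -> ipow fs d.+1 (f * x)
| ipow_add d x y : ipow fs d x -> ipow fs d y -> ipow fs d (x + y).

Lemma ipow_ideal fs d : is_ideal (ipow fs d).
Proof.
split; [exact: ipow_0 | exact: ipow_add |].
move=> a x; elim=> {d x} [x|d|d f x fin _ IH|d x y _ IHx _ IHy].
- exact: ipow_all.
- rewrite mulr0; exact: ipow_0.
- by rewrite mulrCA; apply: ipow_mul.
- by rewrite mulrDr; apply: ipow_add.
Qed.

Lemma ipow_pred fs d x : ipow fs d.+1 x -> ipow fs d x.
Proof.
move e: d.+1 => d' p; elim: p d e => {d' x} [x|d'|d' f x fin _ IH|d' x y _ IHx _ IHy] d // e.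
- exact: ipow_0.
- case: e IH => <-; case: d => [|d] IH; first exact: ipow_all.
  by apply: ipow_mul => //; apply: IH.
- by apply: ipow_add; [apply: IHx | apply: IHy].
Qed.

Lemma ipow_leq fs d d' x : (d <= d')%N -> ipow fs d' x -> ipow fs d x.
Proof.
move=> /subnK <-; elim: (d' - d)%N => // m IH; rewrite addSn.
by move/ipow_pred.
Qed.

Lemma ipow_sub fs fs' d x : {subset fs <= fs'} -> ipow fs d x -> ipow fs' d x.
Proof.
move=> s; elim=> {d x} [x|d|d f x fin _ IH|d x y _ IHx _ IHy].
- exact: ipow_all.
- exact: ipow_0.
- by apply: ipow_mul => //; apply: s.
- exact: ipow_add.
Qed.

(** Sorting products by whether f occurs: (fs')^(d+1) = f (fs')^d +
(fs)^(d+1). The subset hypothesis lets f be removed from either end of fs'. *)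
Lemma ipow_split fs fs' f d x : {subset fs' <= f :: fs} ->
  ipow fs' d.+1 x -> exists a b, [/\ ipow fs' d a, ipow fs d.+1 b & x = f * a + b].
Proof.
move=> s; move e: d.+1 => d' p.
elim: p d e => {d' x} [x|d'|d' f' x fin px IH|d' x y _ IHx _ IHy] d // e.
- exists 0, 0; split; [exact: ipow_0 | exact: ipow_0 | by rewrite mulr0 addr0].
- case: e px IH => <- px IH.
  have := s _ fin; rewrite inE => /orP [/eqP e|f'in].
    exists x, 0; split=> //; [exact: ipow_0 | by rewrite e addr0].
  case: d px IH => [|d] px IH.
    exists 0, (f' * x); split; [exact: ipow_0 | | by rewrite mulr0 add0r].
    by apply: ipow_mul => //; apply: ipow_all.
  have [a [b [pa pb ->]]] := IH _ erefl.
  exists (f' * a), (f' * b); split; [exact: ipow_mul | exact: ipow_mul | ring].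
- have [a [b [pa pb ->]]] := IHx _ e.
  have [a' [b' [pa' pb' ->]]] := IHy _ e.
  by exists (a + a'), (b + b'); split; [exact: ipow_add | exact: ipow_add | ring].
Qed.

Lemma ipow_cons fs f d x : ipow (f :: fs) d.+1 x ->
  exists a b, [/\ ipow (f :: fs) d a, ipow fs d.+1 b & x = f * a + b].
Proof. exact: ipow_split. Qed.

Definition add_ipow J fs d : R -> Prop := fun x => exists2 b, ipow fs d b & J (x - b).

Lemma add_ipow_ideal J fs d : is_ideal J -> is_ideal (add_ipow J fs d).
Proof.
move=> hJ; split.
- by exists 0; [exact: ipow_0 | rewrite subr0; apply: ideal0].
- move=> x y [a pa Ja] [b pb Jb]; exists (a + b); first exact: ipow_add.
  have -> : x + y - (a + b) = (x - a) + (y - b) by ring.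
  by apply: idealD.
- move=> c x [a pa Ja]; exists (c * a); first exact: (idealM (ipow_ideal _ _)).
  by rewrite -mulrBr; apply: idealM.
Qed.

Lemma ipow_in_add_ipow J fs d x : is_ideal J -> ipow fs d x -> add_ipow J fs d x.
Proof. by move=> hJ px; exists x => //; rewrite subrr; apply: ideal0. Qed.

Lemma sub_add_ipow J fs d x : J x -> add_ipow J fs d x.
Proof. by move=> Jx; exists 0; [exact: ipow_0 | rewrite subr0]. Qed.

Lemma add_ipow_leq J fs d d' x : (d <= d')%N -> add_ipow J fs d' x -> add_ipow J fs d x.
Proof. by move=> le [b pb Jb]; exists b => //; apply: ipow_leq pb. Qed.

Lemma add_ipow_all J fs x : is_ideal J -> add_ipow J fs 0 x.
Proof. by move=> hJ; apply: ipow_in_add_ipow => //; apply: ipow_all. Qed.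

Lemma add_ipow_sub J fs fs' d x : {subset fs <= fs'} ->
  add_ipow J fs d x -> add_ipow J fs' d x.
Proof. by move=> s [b pb Jb]; exists b => //; apply: ipow_sub pb. Qed.

Lemma add_ipow_mul J fs d f x : is_ideal J -> f \in fs ->
  add_ipow J fs d x -> add_ipow J fs d.+1 (f * x).
Proof.
move=> hJ fin [b pb Jb]; exists (f * b); first exact: ipow_mul.
by rewrite -mulrBr; apply: idealM.
Qed.

Lemma add_ipow_adjoin J f fs d x : is_ideal J ->
  add_ipow J (f :: fs) d x -> add_ipow (adjoin J f) fs d x.
Proof.
move=> hJ [b pb Jb]; case: d pb => [|d] pb.
  by apply/add_ipow_all/adjoin_ideal.
have [a [c [pa pc e]]] := ipow_cons pb.
exists c => //; exists a.
by have -> : x - c - a * f = x - b by rewrite e; ring.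
Qed.

Lemma add_ipow_nil J d x : is_ideal J -> add_ipow J [::] d.+1 x -> J x.
Proof.
move=> hJ [b pb Jb]; suff b0 : b = 0 by rewrite b0 subr0 in Jb.
move: pb; move e: d.+1 => d' pb.
elim: pb d e => {b Jb d'} // d' a b _ IHa _ IHb d e.
by rewrite (IHa _ e) (IHb _ e) addr0.
Qed.

(** Quasi-regularity of regular sequences, stated without associated graded
rings: the element following fs, and also the element preceding fs, is regular
modulo J + (fs)^d. Both halves are proved together by induction on the length
of fs. Each expands the power with [ipow_split], uses the first half for fs
without one end element over J + (f), f the head of the sequence, to reduce to
multiples of f, and concludes with the second half for the shorter sequence
and an inner induction on d. *)
Lemma regular_add_ipow n :
  (forall J fs g d, is_ideal J -> size fs = n ->
     weakly_regular J (rcons fs g) -> regular_mod (add_ipow J fs d) g) /\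
  (forall J fs f d, is_ideal J -> size fs = n ->
     weakly_regular J (f :: fs) -> regular_mod (add_ipow J fs d) f).
Proof.
elim: n => [|n [A D]].
  have E J f d : is_ideal J -> regular_mod J f -> regular_mod (add_ipow J [::] d) f.
    move=> hJ r h; case: d => [|d]; first by move=> _; apply: add_ipow_all.
    by move/add_ipow_nil => /(_ hJ) /r; apply: sub_add_ipow.
  by split=> J fs f d hJ /size0nil -> [r _]; apply: E.
split=> J fs f.
  (* Here f is the last element and f1 the head that is split off. *)
  case: fs => [|f1 fs] //= d hJ [sz] [r1 rs].
  elim: d => [|d IHd] h ch; first exact: add_ipow_all.
  have hJ1 := adjoin_ideal f1 hJ.
  have [h'' ph'' [h' Jh]] := A _ _ _ _ hJ1 sz rs _ (add_ipow_adjoin hJ ch).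
  have [c pc Jc] := ch.
  have [a [b [pa pb ec]]] := ipow_cons pc.
  have D1 : weakly_regular J (f1 :: fs).
    by split=> //; case/weakly_regular_rcons: rs.
  have := D _ _ _ d.+1 hJ sz D1 (f * h' - a); case.
    have -> : f1 * (f * h' - a) =
      (f * h - c) + (- f) * (h - h'' - h' * f1) + (b - f * h'') by rewrite ec; ring.
    have hP := add_ipow_ideal fs d.+1 hJ.
    apply: idealD => //; first apply: idealD => //.
    - exact: sub_add_ipow.
    - by apply: idealM => //; apply: sub_add_ipow.
    - apply: ipow_in_add_ipow => //; apply: idealB => //; first exact: ipow_ideal.
      by apply: idealM => //; apply: ipow_ideal.
  move=> w pw Jw.
  have hP := add_ipow_ideal (f1 :: fs) d hJ.
  have sub : {subset fs <= f1 :: fs} by move=> u; rewrite inE => ->; rewrite orbT.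
  have h'in : add_ipow J (f1 :: fs) d h'.
    apply: IHd; exists (w + a).
      by apply: ipow_add => //; apply: ipow_pred; apply: ipow_sub pw.
    by have -> : f * h' - (w + a) = f * h' - a - w by ring.
  have -> : h = (h - h'' - h' * f1) + (f1 * h' + h'') by ring.
  have hP1 := add_ipow_ideal (f1 :: fs) d.+1 hJ.
  apply: idealD => //; first exact: sub_add_ipow.
  apply: idealD => //.
    by apply: add_ipow_mul => //; rewrite inE eqxx.
  by apply: ipow_in_add_ipow => //; apply: ipow_sub ph''.
(* Here f is the head and the last element g is split off. *)
case/lastP: fs => [|fs g] // d hJ; rewrite size_rcons => -[sz] rs.
have sub : {subset fs <= rcons fs g}.
  by move=> u; rewrite mem_rcons inE => ->; rewrite orbT.
have [_ rs'] := rs.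
have D1 : weakly_regular J (f :: fs).
  by have /weakly_regular_rcons[] : weakly_regular J (rcons (f :: fs) g) by [].
elim: d => [|d IHd] y fy; first exact: add_ipow_all.
have hJ1 := adjoin_ideal f hJ.
have [c pc Jc] := fy.
have s2 : {subset rcons fs g <= g :: fs} by move=> u; rewrite mem_rcons.
have [b [a [pb pa ec]]] := ipow_split s2 pc.
have := A _ _ _ d.+1 hJ1 sz rs' b; case.
  exists (- a); first by apply: idealN => //; apply: ipow_ideal.
  exists y; have -> : g * b - - a - y * f = - (f * y - c) by rewrite ec; ring.
  exact: idealN.
move=> b'' pb'' [b' Jb'].
have h1 : add_ipow J fs d.+1 (y - g * b').
  apply: (D _ _ _ _ hJ sz D1).
  have -> : f * (y - g * b') = (f * y - c) + g * (b - b'' - b' * f) + (a + g * b'').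
    by rewrite ec; ring.
  have hP := add_ipow_ideal fs d.+1 hJ.
  apply: idealD => //; first apply: idealD => //.
  - exact: sub_add_ipow.
  - by apply: idealM => //; apply: sub_add_ipow.
  - apply: ipow_in_add_ipow => //; apply: ipow_add => //.
    by apply: idealM => //; apply: ipow_ideal.
have h2 : add_ipow J (rcons fs g) d b'.
  apply: IHd.
  have -> : f * b' = - (b - b'' - b' * f) + (b - b'') by ring.
  have hP := add_ipow_ideal (rcons fs g) d hJ.
  apply: idealD => //; first by apply: idealN => //; apply: sub_add_ipow.
  apply: ipow_in_add_ipow => //; apply: idealB => //; first exact: ipow_ideal.
  by apply: ipow_pred; apply: ipow_sub pb''.
have -> : y = g * b' + (y - g * b') by ring.
have hP := add_ipow_ideal (rcons fs g) d.+1 hJ.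
apply: idealD => //.
  by apply: add_ipow_mul => //; rewrite mem_rcons inE eqxx.
exact: add_ipow_sub h1.
Qed.

(** The initial form of f, the head of a regular sequence, is a nonzerodivisor
of the associated graded ring. *)
Lemma head_cancel J f fs d h : is_ideal J -> weakly_regular J (f :: fs) ->
  add_ipow J (f :: fs) d.+1 (f * h) -> add_ipow J (f :: fs) d h.
Proof.
move=> hJ rs [c pc Jc].
have [a [b [pa pb ec]]] := ipow_cons pc.
have [_ D] := regular_add_ipow (size fs).
have := D _ _ _ d.+1 hJ erefl rs (h - a); case.
  exists b => //; have -> : f * (h - a) - b = f * h - c by rewrite ec; ring.
  by [].
move=> w pw Jw; exists (w + a).
  apply: ipow_add => //; apply: ipow_pred; apply: ipow_sub pw.
  by move=> u; rewrite inE => ->; rewrite orbT.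
by have -> : h - (w + a) = h - a - w by ring.
Qed.

(** The values Q(fs) of nonzero polynomials Q, generalized: with f the
variable of the head of fs, a nonzero Q is f^a (G + f H) where G is a nonzero
polynomial in the remaining variables; here h, the value of H, may be
arbitrary in R, which spares the bookkeeping of polynomials in fs. *)
Inductive nonzero_value : seq R -> R -> Prop :=
| nonzero_value_unit c c' : c' * c = 1 -> nonzero_value [::] c
| nonzero_value_cons f fs a g h :
    nonzero_value fs g -> nonzero_value (f :: fs) (f ^+ a * (g + f * h)).

(** A value of a nonzero polynomial is a nonzerodivisor for the topology of
the (fs)-adic filtration. After the power of f is cancelled, work modulo f:
there g cancels by induction, so z = f z1 + w modulo J with w in a high power
of (fs); then f z1 inherits the hypothesis on z, with a smaller exponent, and
z1 is treated by induction on N. *)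
Lemma nonzero_value_cancel fs q : nonzero_value fs q ->
  forall J, is_ideal J -> weakly_regular J fs ->
  forall N, exists N', forall z, add_ipow J fs N' (q * z) -> add_ipow J fs N z.
Proof.
elim=> {fs q} [c c' cc'|f fs a g h _ IH] J hJ rs N.
  exists N => z qz; rewrite -[z]mul1r -cc' -mulrA.
  by apply: idealM => //; apply: add_ipow_ideal.
suff [N' H] : exists N', forall z, add_ipow J (f :: fs) N' ((g + f * h) * z) ->
    add_ipow J (f :: fs) N z.
  exists (a + N')%N => z; rewrite -mulrA => qz; apply: H.
  elim: a qz => [|a IHa]; first by rewrite expr0 mul1r.
  by rewrite exprS -mulrA addSn => /head_cancel; auto.
have [r rs'] := rs.
have hJ1 := adjoin_ideal f hJ.
elim: N => [|N [N1 IHN]]; first by exists 0%N => z _; apply: add_ipow_all.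
(* L exceeds both the exponent needed to treat z1 and the target exponent. *)
pose L := (N1 + N).+1.
have [NG HG] := IH _ hJ1 rs' L.
exists (NG + L)%N => z qz.
have : add_ipow (adjoin J f) fs NG (g * z).
  have := add_ipow_adjoin hJ (add_ipow_leq (leq_addr L NG) qz).
  have -> : (g + f * h) * z = g * z + (h * z) * f by ring.
  have hP := add_ipow_ideal fs NG hJ1.
  move=> H; have -> : g * z = g * z + (h * z) * f - (h * z) * f by ring.
  apply: idealB => //; apply: sub_add_ipow; exact: adjoin_mem.
case/HG=> w pw [z1 Jz].
have sub : {subset fs <= f :: fs} by move=> u; rewrite inE => ->; rewrite orbT.
have hP := add_ipow_ideal (f :: fs) L hJ.
have z1in : add_ipow J (f :: fs) N z1.
  apply: IHN; apply: (@add_ipow_leq _ _ _ (N1 + N)); first exact: leq_addr.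
  apply: head_cancel => //.
  have -> : f * ((g + f * h) * z1) = (g + f * h) * z
     - ((g + f * h) * w + (g + f * h) * (z - w - z1 * f)) by ring.
  apply: idealB => //; first by apply: add_ipow_leq qz; apply: leq_addl.
  apply: idealD => //; apply: idealM => //; last exact: sub_add_ipow.
  by apply: ipow_in_add_ipow => //; apply: ipow_sub pw.
have -> : z = f * z1 + (z - w - z1 * f) + w by ring.
have hPN := add_ipow_ideal (f :: fs) N.+1 hJ.
apply: idealD => //; first apply: idealD => //.
- by apply: add_ipow_mul => //; rewrite inE eqxx.
- exact: sub_add_ipow.
- apply: ipow_in_add_ipow => //; apply: ipow_sub sub _; apply: ipow_leq pw.
  by rewrite ltnS leq_addl.
Qed.

(** Regularity on the two outer terms of 0 -> R/(J : u) -> R/J -> R/(J + u) ->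
0 gives regularity on the middle one. Regularity of f on R/(J + u) keeps the
sequence exact modulo f: this is the equality of (J + f : u) with (J : u) + f,
which lets the induction go on. *)
Lemma weakly_regular_extension J u fs : is_ideal J ->
  weakly_regular (adjoin J u) fs -> weakly_regular (colon J u) fs ->
  weakly_regular J fs.
Proof.
elim: fs J => //= f fs IH J hJ [r1 rs1] [r2 rs2]; split.
  move=> h fh.
  have [a Ja] := r1 h (sub_adjoin _ fh).
  suff Jua : J (u * a).
    have -> : h = (h - a * u) + u * a by ring.
    exact: idealD.
  apply: r2; rewrite /colon.
  have -> : u * (f * a) = f * h - f * (h - a * u) by ring.
  by apply: idealB => //; apply: idealM.
apply: IH; first exact: adjoin_ideal.
  by apply: weakly_regular_iff rs1 => x; split; apply: adjoin_swap.
apply: weakly_regular_iff rs2 => x; rewrite /colon; split=> [[a Ja]|[b Jb]].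
  exists (u * a); have -> : u * x - u * a * f = u * (x - a * f) by ring.
  exact: Ja.
have [b' Jb'] : adjoin J u b.
  apply: r1; exists x.
  have -> : f * b - x * u = - (u * x - b * f) by ring.
  exact: idealN.
exists b'; rewrite /colon.
have -> : u * (x - b' * f) = (u * x - b * f) + f * (b - b' * u) by ring.
by apply: idealD => //; apply: idealM.
Qed.

(** The half of the exchange of neighbours in a regular sequence that holds in
any ring. *)
Lemma regular_adjoin J x f : is_ideal J -> regular_mod J x ->
  regular_mod (adjoin J x) f -> regular_mod (adjoin J f) x.
Proof.
move=> hJ rx rf y [b Jb].
have [b' Jb'] : adjoin J x b.
  apply: rf; exists y.
  have -> : f * b - y * x = - (x * y - b * f) by ring.
  exact: idealN.
exists b'; apply: rx.
have -> : x * (y - b' * f) = (x * y - b * f) + f * (b - b' * x) by ring.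
by apply: idealD => //; apply: idealM.
Qed.

Lemma regular_mod_prod J (I : Type) (r : seq I) (P : pred I) (F : I -> R) :
  (forall i, P i -> regular_mod J (F i)) -> regular_mod J (\prod_(i <- r | P i) F i).
Proof.
move=> H; elim/big_rec: _ => [h|i x Pi IH h]; first by rewrite mul1r.
by rewrite -mulrA => /(H _ Pi) /IH.
Qed.

End Ideals.

(** * Monomial ideals and depth from above *)

Section MonomialIdeals.
Import GRing.Theory.
Local Open Scope ring_scope.
Variables (K : fieldType) (n : nat).
Local Notation S := {mpoly K[n]}.
Implicit Types (m : 'X_{1..n}) (f g p q : S) (fs : seq S) (A B D Z U : {set 'I_n}).
Implicit Types (N : pred {set 'I_n}).

Definition mnm_supp m : {set 'I_n} := [set i | m i != 0%N].

Definition upward N : Prop := forall A B, A \subset B -> N A -> N B.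

(** The Stanley-Reisner ideal of the complex whose nonfaces are the sets
satisfying N, when N is upward closed. *)
Definition mon_ideal N : S -> Prop := fun f => forall m, m \in msupp f -> N (mnm_supp m).

Lemma mnm_suppD m1 m2 : mnm_supp (m1 + m2)%MM = mnm_supp m1 :|: mnm_supp m2.
Proof. by apply/setP=> i; rewrite !inE mnmDE addn_eq0 negb_and. Qed.

Lemma mnm_supp1 i : mnm_supp U_(i)%MM = [set i].
Proof. by apply/setP=> j; rewrite !inE mnm1E [j == i]eq_sym; case: (i == j). Qed.

Lemma mnm_supp_mesym1 A : mnm_supp (mesym1 A) = A.
Proof. by apply/setP=> j; rewrite !inE mnmE; case: (j \in A). Qed.

Lemma mesym1_leP A m : A \subset mnm_supp m -> (mesym1 A <= m)%MM.
Proof.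
move=> /subsetP s; apply/mnm_lepP=> i; rewrite mnmE.
by case: (boolP (i \in A)) => // /s; rewrite inE lt0n.
Qed.


Lemma msuppM_split f g m : m \in msupp (f * g) ->
  exists m1 m2, [/\ m1 \in msupp f, m2 \in msupp g & m = (m1 + m2)%MM].
Proof. by move/msuppM_le/allpairsP=> [[m1 m2] [? ? ->]]; exists m1, m2. Qed.

Lemma msuppD_split f g m : m \in msupp (f + g) -> m \in msupp f \/ m \in msupp g.
Proof. by move/msuppD_le; rewrite mem_cat => /orP. Qed.

Lemma mon_ideal_ideal N : upward N -> is_ideal (mon_ideal N).
Proof.
move=> up; split.
- by move=> m; rewrite msupp0.
- by move=> f g If Ig m /msuppD_split [/If|/Ig].
- move=> a f If m /msuppM_split [m1 [m2 [_ /If Nm2 ->]]].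
  by apply: up Nm2; rewrite mnm_suppD subsetUr.
Qed.

Lemma mon_idealX N m : N (mnm_supp m) -> mon_ideal N 'X_[m].
Proof. by move=> Nm m'; rewrite msuppX inE => /eqP ->. Qed.

Lemma mon_ideal_min (J : S -> Prop) N : is_ideal J ->
  (forall m, N (mnm_supp m) -> J 'X_[m]) -> forall f, mon_ideal N f -> J f.
Proof.
move=> hJ H f If; rewrite [f]mpolyE big_seq.
elim/big_rec: _ => [|m x /If /H Jm Jx]; first exact: ideal0.
by apply: idealD => //; rewrite -mul_mpolyC; apply: idealM.
Qed.

Lemma mon_ideal_adjoin N i f : upward N ->
  adjoin (mon_ideal N) 'X_i f <-> mon_ideal (fun A => N A || (i \in A)) f.
Proof.
move=> up; split.
  move=> [a Ia] m; have -> : f = (f - a * 'X_i) + a * 'X_i by ring.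
  case/msuppD_split=> [/Ia -> //|/msuppM_split [m1 [m2 [_ ]]]].
  by rewrite msuppX inE => /eqP -> ->; rewrite mnm_suppD mnm_supp1 !inE eqxx !orbT.
have hJ := adjoin_ideal 'X_i (mon_ideal_ideal up).
apply: mon_ideal_min => // m /orP [/mon_idealX|]; first exact: sub_adjoin.
rewrite inE => mi; have : (U_(i) <= m)%MM.
  by apply/mnm_lepP=> j; rewrite mnm1E; case: eqP => // <-; rewrite lt0n.
move/submK=> <-; rewrite mpolyXD; apply: adjoin_mem; exact: mon_ideal_ideal.
Qed.

(** The colon by a variable passes to the link of a vertex, as adjoining the
variable in [mon_ideal_adjoin] deletes the vertex. *)
Lemma mon_ideal_colon N i f :
  colon (mon_ideal N) 'X_i f <-> mon_ideal (fun A => N (i |: A)) f.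
Proof.
rewrite /colon mulrC /mon_ideal; split=> H m.
  move=> mf; rewrite -mnm_supp1 -mnm_suppD; apply: H.
  by rewrite (perm_mem (msuppMX _ _)) map_f.
rewrite (perm_mem (msuppMX _ _)) => /mapP [m' /H Nm ->].
by rewrite mnm_suppD mnm_supp1.
Qed.

Lemma ideal_gen_ideal (P : S -> Prop) : is_ideal (ideal_gen P).
Proof.
split.
- by exists [::]; split=> //; rewrite big_nil.
- move=> f g [s [Ps ->]] [t [Pt ->]]; exists (s ++ t); rewrite big_cat; split=> // p.
  by rewrite mem_cat => /orP [/Ps|/Pt].
- move=> a f [s [Ps ->]]; exists [seq ((a : S) * p.1, p.2) | p : S * S <- s]; split.
    by move=> p /mapP [p' /Ps Pp ->].
  by rewrite big_map mulr_sumr; apply: eq_bigr => p _; rewrite mulrA.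
Qed.

Lemma ideal_gen_mem (P : S -> Prop) f : P f -> ideal_gen P f.
Proof.
move=> Pf; exists [:: (1, f)]; split; first by move=> p; rewrite inE => /eqP ->.
by rewrite big_seq1 mul1r.
Qed.

Lemma ideal_gen_min (P J : S -> Prop) : is_ideal J -> (forall f, P f -> J f) ->
  forall f, ideal_gen P f -> J f.
Proof.
move=> hJ H f [s [Ps ->]]; rewrite big_seq.
elim/big_rec: _ => [|p x /Ps /H Jp Jx]; first exact: ideal0.
by apply: idealD => //; apply: idealM.
Qed.

Lemma adjoin_seq_min (J J' : S -> Prop) fs : is_ideal J' -> (forall f, J f -> J' f) ->
  (forall f, f \in fs -> J' f) -> forall f, adjoin_seq J fs f -> J' f.
Proof.
move=> hJ'; elim: fs J => //= g fs IH J s H.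
apply: IH => [f [a /s Ja]|f fin]; last by apply: H; rewrite inE fin orbT.
have -> : f = (f - a * g) + a * g by ring.
by apply: idealD => //; apply: idealM => //; apply: H; rewrite inE eqxx.
Qed.

Lemma sub_adjoin_seq (J : S -> Prop) fs f : J f -> adjoin_seq J fs f.
Proof. by elim: fs J => //= g fs IH J Jf; apply/IH/sub_adjoin. Qed.

Lemma adjoin_seq_mem (J : S -> Prop) fs f : is_ideal J -> f \in fs -> adjoin_seq J fs f.
Proof.
elim: fs J => //= g fs IH J hJ; rewrite inE => /orP [/eqP ->|]; last first.
  by apply: IH; apply: adjoin_ideal.
by apply: sub_adjoin_seq; have := adjoin_mem g 1 hJ; rewrite mul1r.
Qed.

Lemma ideal_add_seqE (J : S -> Prop) fs f : is_ideal J ->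
  ideal_add_seq J fs f <-> adjoin_seq J fs f.
Proof.
move=> hJ; split.
  apply: ideal_gen_min; first exact: adjoin_seq_ideal.
  by move=> g [Jg|gin]; [apply: sub_adjoin_seq | apply: adjoin_seq_mem].
apply: adjoin_seq_min; first exact: ideal_gen_ideal.
  by move=> g Jg; apply: ideal_gen_mem; left.
by move=> g gin; apply: ideal_gen_mem; right.
Qed.

Lemma regular_sequenceE (J : S -> Prop) fs : is_ideal J ->
  regular_sequence J fs <-> weakly_regular J fs /\ ~ adjoin_seq J fs 1.
Proof.
move=> hJ; rewrite /regular_sequence ideal_add_seqE //.
suff H : (forall i, (i < size fs)%N ->
     regular_on_quotient (ideal_add_seq J (take i fs)) (nth 0 fs i)) <->
     weakly_regular J fs by split=> [[/H]|[/H]].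
elim/last_ind: fs => [|fs g IH]; first by split.
rewrite weakly_regular_rcons -IH; split=> [H|[H rg]].
  split=> [i lti|h gh].
    have := H i; rewrite size_rcons ltnS nth_rcons lti -cats1 takel_cat; last exact: ltnW.
    by apply; apply: ltnW.
  have := H (size fs); rewrite size_rcons nth_rcons ltnn eqxx -cats1 take_size_cat //.
  by move=> /(_ (leqnn _) h); rewrite !ideal_add_seqE //; apply.
move=> i; rewrite size_rcons ltnS leq_eqVlt => /orP [/eqP ->|lti].
  rewrite nth_rcons ltnn eqxx -cats1 take_size_cat // => h.
  by rewrite !ideal_add_seqE //; apply: rg.
rewrite nth_rcons lti -cats1 takel_cat; last exact: ltnW.
exact: H.
Qed.

Lemma irrelevant_idealE f : irrelevant_ideal f <-> f@_0%MM = 0.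
Proof.
split.
  case=> s [Ps ->]; rewrite raddf_sum big_seq big1 //= => p /Ps [i ->].
  apply/eqP; rewrite mcoeff_eq0; apply/negP => /msuppM_split [m1 [m2 [_ ]]].
  rewrite msuppX inE => /eqP -> /esym /eqP.
  by rewrite mnmD_eq0 mnm1_eq0 andbF.
move=> f0; have hJ : is_ideal (@irrelevant_ideal K n) by apply: ideal_gen_ideal.
apply: (@mon_ideal_min _ (fun A => A != set0)) => //.
  move=> m /set0Pn [i]; rewrite inE => mi.
  have : (U_(i) <= m)%MM.
    by apply/mnm_lepP=> j; rewrite mnm1E; case: eqP => // <-; rewrite lt0n.
  move/submK=> <-; rewrite mpolyXD; apply: idealM => //.
  by apply: ideal_gen_mem; exists i.
move=> m; rewrite mcoeff_msupp; apply: contraNneq => /setP m0.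
suff -> : m = 0%MM by rewrite f0.
by apply/mnmP=> i; have := m0 i; rewrite !inE mnm0E; case: (m i).
Qed.

Lemma ipow_mdeg fs d f : (forall g, g \in fs -> g@_0%MM = 0) -> ipow fs d f ->
  forall m, m \in msupp f -> (d <= mdeg m)%N.
Proof.
move=> H; elim=> {d f} // [d|d g f gin _ IH|d f g _ IHf _ IHg] m.
- by rewrite msupp0.
- case/msuppM_split=> [m1 [m2 [m1in /IH le ->]]]; rewrite mdegD -add1n leq_add //.
  rewrite lt0n mdeg_eq0; apply: contraTneq m1in => ->.
  by rewrite mcoeff_msupp H ?eqxx.
- by case/msuppD_split=> [/IHf|/IHg].
Qed.

Section Dependence.
Variable B : nat.

(** The monomial in fs whose exponents are the digits of i in base B.
Numbering the exponent vectors with entries below B by a single natural number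
turns a linear combination of these monomials into a plain sum, and turns the
expansion along the first variable into Euclidean division. *)
Fixpoint digit_monomial fs (i : nat) : S :=
  if fs is f :: fs' then
    f ^+ (i %/ B ^ size fs') * digit_monomial fs' (i %% B ^ size fs')
  else 1.

Definition digit_comb fs (c : nat -> K) : S :=
  \sum_(0 <= i < B ^ size fs) c i *: digit_monomial fs i.

Lemma digit_comb_cons f fs c : digit_comb (f :: fs) c =
  \sum_(0 <= j < B) f ^+ j * digit_comb fs (fun i => c (j * B ^ size fs + i)%N).
Proof.
rewrite /digit_comb /= expnS big_nat_mul; apply: eq_big_nat => j _.
rewrite mulr_sumr -{1}[(j * B ^ size fs)%N]add0n big_addn mulSn addnK.
apply: eq_big_nat => i /andP[_ lti].
have P0 : (0 < B ^ size fs)%N by apply: leq_ltn_trans lti.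
rewrite [(i + _)%N]addnC divnMDl // modnMDl divn_small // modn_small // addn0.
by rewrite scalerAr.
Qed.

(** The exponent a of [nonzero_value_cons] is the least leading digit j
carrying a nonzero coefficient. *)
Lemma nonzero_value_digit_comb fs (c : nat -> K) i0 : (i0 < B ^ size fs)%N -> c i0 != 0 ->
  nonzero_value fs (digit_comb fs c).
Proof.
elim: fs c i0 => [|f fs IH] c i0 lti ci.
  move: lti; rewrite expn0 ltnS leqn0 => /eqP i00; rewrite i00 in ci.
  apply: (@nonzero_value_unit _ _ ((c 0%N)^-1)%:MP).
  by rewrite /digit_comb expn0 big_nat1 /= -mul_mpolyC mulr1 -mpolyCM mulVf.
pose P := (B ^ size fs)%N.
pose bad j := [exists i : 'I_P, c (j * P + i)%N != 0].
have P0 : (0 < P)%N.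
  by rewrite lt0n; apply: contraTneq lti => /=; rewrite expnS -/P => ->; rewrite muln0.
have bad0 : bad (i0 %/ P)%N.
  by apply/existsP; exists (Ordinal (ltn_pmod i0 P0)); rewrite /= -divn_eq.
have ex : exists j, bad j by exists (i0 %/ P)%N.
case: (ex_minnP ex) => j /existsP [i cji] jmin.
have ltj : (j < B)%N.
  by apply: leq_ltn_trans (jmin _ bad0) _; rewrite ltn_divLR // -expnS.
rewrite digit_comb_cons (big_cat_nat (leq0n j) (ltnW ltj)) /= big_nat big1 ?add0r; last first.
  move=> j' /andP[_ ltj']; rewrite /digit_comb big_nat big1 ?mulr0 // => i' /andP[_ lti'].
  apply/eqP; rewrite -mul_mpolyC; suff -> : c (j' * B ^ size fs + i')%N = 0 by rewrite mul0r.
  apply/eqP; apply: contraTT ltj' => nz; rewrite -leqNgt; apply: jmin.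
  by apply/existsP; exists (Ordinal lti').
rewrite (big_ltn ltj).
set G := digit_comb _ _.
set s := (X in _ + X).
have [h eh] : exists h, s = f ^+ j * (f * h).
  exists (\sum_(j.+1 <= l < B) f ^+ (l - j.+1) *
     digit_comb fs (fun i => c (l * B ^ size fs + i)%N)).
  rewrite mulrA -exprSr mulr_sumr; apply: eq_big_nat => l /andP[lel _].
  by rewrite mulrA -exprD subnKC.
rewrite eh -mulrDr; apply: nonzero_value_cons.
exact: (IH _ i).
Qed.

Lemma digit_monomial_mdeg fs d i m :
  (forall f m, f \in fs -> m \in msupp f -> (mdeg m <= d)%N) ->
  (i < B ^ size fs)%N -> m \in msupp (digit_monomial fs i) -> (mdeg m <= size fs * (B * d))%N.
Proof.
move=> H; elim: fs H i m => [|f fs IH] H i m.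
  by move=> _; rewrite /= msupp1 inE => /eqP ->; rewrite mdeg0.
rewrite /= expnS => lti /msuppM_split [m1 [m2 [m1in m2in ->]]].
have P0 : (0 < B ^ size fs)%N.
  by rewrite lt0n; apply: contraTneq lti => ->; rewrite muln0.
rewrite mdegD mulSn leq_add //; last first.
  apply: IH m2in => [g m' gin|]; last by rewrite ltn_mod.
  by apply: H; rewrite inE gin orbT.
have : (i %/ B ^ size fs < B)%N by rewrite ltn_divLR.
move: (i %/ _)%N m1in => a m1in lta.
suff : (mdeg m1 <= a * d)%N by move/leq_trans; apply; rewrite leq_mul2r ltnW ?orbT.
elim: a m1 m1in {lta} => [|a IHa] m1.
  by rewrite expr0 msupp1 inE => /eqP ->; rewrite mdeg0.
rewrite exprS => /msuppM_split [m3 [m4 [m3in m4in ->]]].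
by rewrite mdegD mulSn leq_add ?IHa //; apply: H m3in; rewrite inE eqxx.
Qed.

End Dependence.

Lemma kernel_row (I J : finType) (a : I -> J -> K) : (#|J| < #|I|)%N ->
  exists u : I -> K, (exists i, u i != 0) /\ forall j, \sum_i u i * a i j = 0.
Proof.
move=> lt; pose A := \matrix_(i < #|I|, j < #|J|) a (enum_val i) (enum_val j).
have : kermx A != 0.
  rewrite kermx_eq0 -row_leq_rank -ltnNge.
  exact: leq_ltn_trans (rank_leq_col A) lt.
case/rowV0Pn=> v /sub_kermxP vA v0.
exists (fun i => v 0 (enum_rank i)); split.
  have /rV0Pn [i vi] := v0; exists (enum_val i); by rewrite enum_valK.
move=> j; have /rowP /(_ (enum_rank j)) := vA.
rewrite !mxE => vAj; rewrite -[RHS]vAj [RHS](reindex (@enum_rank I)) /=; last first.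
  by apply: onW_bij; apply: enum_rank_bij.
by apply: eq_bigr => i _; rewrite !mxE !enum_rankK.
Qed.

(** Let B bound the exponents. There are B^r monomials in fs, r = size fs, of
degree at most r B d, where d bounds the degrees in fs; they involve at most
(r B d + 1)^s monomials in the s = #|D| variables of D. As r > s, the first
number exceeds the second for large B, so a nontrivial combination of the
monomials in fs has no term supported in D. *)
Lemma algebraic_dependence fs D : (#|D| < size fs)%N ->
  exists2 q, nonzero_value fs q & forall m, mnm_supp m \subset D -> q@_m = 0.
Proof.
move=> lt.
pose d := (\max_(f <- fs) msize f)%N.
have fsd f m : f \in fs -> m \in msupp f -> (mdeg m <= d)%N.
  move=> fin /msize_mdeg_lt /ltnW /leq_trans; apply.
  rewrite /d (big_rem f) //=; exact: leq_maxl.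
(* With these choices (r B d + 1)^s <= (B C)^s < B^(s+1) <= B^r. *)
pose r := size fs; pose C := (r * d).+1; pose B := (C ^ #|D|).+1.
pose E := (r * (B * d)).+1.
pose J : finType := {ffun {i | i \in D} -> 'I_E}.
pose mon (t : J) : 'X_{1..n} :=
  [multinom (if insub i is Some u then val (t u) else 0)%N | i < n].
have card : (#|J| < #|'I_(B ^ r)|)%N.
  rewrite card_ord card_ffun card_ord card_sig.
  have -> : #|[pred i | i \in D]| = #|D| by apply: eq_card.
  have leE : (E <= B * C)%N by rewrite /E mulnCA /C [(B * _.+1)%N]mulnS addnC -addn1 leq_add2l.
  apply: (@leq_ltn_trans ((B * C) ^ #|D|)%N).
    by case: (#|D|) => [|s]; rewrite ?expn0 // leq_exp2r.
  apply: (@leq_trans (B ^ #|D|.+1)%N); last exact: leq_pexp2l.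
  by rewrite expnMn expnSr ltn_pmul2l ?expn_gt0.
have [u [[i0 ui0] uker]] :=
  kernel_row (fun (i : 'I_(B ^ r)) (t : J) => (digit_monomial B fs i)@_(mon t)) card.
pose c (i : nat) := if insub i is Some i' then u i' else 0.
have cE (i : 'I_(B ^ r)) : c i = u i by rewrite /c valK.
exists (digit_comb B fs c).
  by apply: (@nonzero_value_digit_comb _ _ _ i0); rewrite ?ltn_ord ?cE.
move=> m mD; rewrite /digit_comb raddf_sum big_mkord /=.
case: (leqP E (mdeg m)) => [ltm|lem].
  rewrite big1 // => i _; rewrite mcoeffZ; apply/eqP; rewrite mulf_eq0.
  rewrite mcoeff_eq0; apply/orP; right; apply: contraTN ltm => mi.
  by rewrite -leqNgt; apply: (digit_monomial_mdeg fsd _ mi).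
(* A monomial of degree below E supported in D has its exponents listed in J. *)
pose t : J := [ffun i => inord (m (val i))].
suff -> : m = mon t.
  by rewrite -[RHS](uker t); apply: eq_bigr => i _; rewrite mcoeffZ cE.
apply/mnmP=> i; rewrite mnmE; case: insubP => [v vD vi|niD] /=.
  rewrite ffunE inordK ?vi //; apply: leq_ltn_trans lem.
  by rewrite mdegE (bigD1 i) //= leq_addr.
apply/eqP; apply: contraNT niD => mi; apply: (subsetP mD); by rewrite inE.
Qed.

(** For a facet D, the class of x_D spans a copy of the polynomial ring on D
inside S / I, and a sequence regular on S / I is at most as long as that ring
has variables. *)
Theorem regular_length_le N D fs : upward N -> ~~ N D ->
  (forall v, v \notin D -> N (v |: D)) -> (forall f, f \in fs -> f@_0%MM = 0) ->
  weakly_regular (mon_ideal N) fs -> (size fs <= #|D|)%N.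
Proof.
move=> up ND facet f0 rs; rewrite leqNgt; apply/negP => /algebraic_dependence [q nz qD].
have hI := mon_ideal_ideal up.
have [N' cancel] := nonzero_value_cancel nz hI rs #|D|.+1.
pose xD : S := 'X_[mesym1 D].
have : mon_ideal N (q * xD).
  move=> m /msuppM_split [m1 [m2 [m1q]]]; rewrite msuppX inE => /eqP -> ->.
  have /subsetPn [v vm1 vD] : ~~ (mnm_supp m1 \subset D).
    by apply: contraTN m1q => /qD; rewrite mcoeff_msupp => ->; rewrite eqxx.
  apply: up (facet v vD); rewrite mnm_suppD mnm_supp_mesym1.
  by rewrite subUset sub1set inE vm1 /= subsetUr.
move/(@sub_add_ipow _ _ fs N') /cancel => [b pb Ib].
case/negP: ND; rewrite -(mnm_supp_mesym1 D); apply: Ib.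
rewrite mcoeff_msupp mcoeffB mcoeffX eqxx memN_msupp_eq0 ?subr0 ?oner_eq0 //.
apply/negP => /(ipow_mdeg f0 pb); by rewrite mdeg_mesym1 ltnn.
Qed.

End MonomialIdeals.

(** * Elementary symmetric polynomials and depth from below *)

Section LowerBound.
Import GRing.Theory.
Local Open Scope ring_scope.
Variables (K : fieldType) (n : nat).
Local Notation S := {mpoly K[n]}.
Implicit Types (J : S -> Prop) (m : 'X_{1..n}) (f g p q : S) (fs : seq S).
Implicit Types (A B D Z U : {set 'I_n}).
Implicit Types (N : pred {set 'I_n}).
Local Notation hc := (pihomog mdeg).

Definition graded J : Prop := forall f d, J f -> J (hc d f).

Lemma pihomogM_homog g e d f : g \is e.-homog ->
  hc d (f * g) = if (e <= d)%N then hc (d - e) f * g else 0.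
Proof.
move=> hg; elim/mpolyind: f => [|c m f _ _ IH].
  by rewrite mul0r !pihomog0 mul0r if_same.
rewrite mulrDl !pihomogD {}IH -scalerAl !linearZ /= pihomogX.
have hX : 'X_[m] * g \is (mdeg m + e).-homog by apply: dhomogM => //; rewrite dhomogX.
have -> : hc d ('X_[m] * g) = if (mdeg m + e == d)%N then 'X_[m] * g else 0.
  by case: eqP => [<-|/eqP ne]; [apply: pihomog_dE | apply: pihomog_ne0 hX].
case: leqP => [le|lt]; last first.
  by rewrite ifF ?scaler0 ?addr0 //; apply/negbTE; lia.
rewrite mulrDl -scalerAl; congr (_ + _); congr (_ *: _).
have -> : (mdeg m + e == d)%N = (mdeg m == d - e)%N by lia.
by case: ifP; rewrite ?mul0r.
Qed.

Lemma graded_adjoin J f e : is_ideal J -> graded J -> f \is e.-homog ->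
  graded (adjoin J f).
Proof.
move=> hJ gJ hf g d [a /(gJ _ d)]; rewrite pihomogB (pihomogM_homog _ _ hf).
case: leqP => _ Ja; first by exists (hc (d - e) a).
by exists 0; rewrite mul0r.
Qed.

Lemma graded_mon_ideal N : graded (mon_ideal N).
Proof.
move=> f d If m; rewrite mcoeff_msupp pihomogE raddf_sum /= => nz; apply: If.
apply: contraNT nz => mf; rewrite big_seq_cond big1 // => m' /andP[m'f _].
rewrite mcoeffZ mcoeffX; case: eqP => [e|_]; last by rewrite mulr0.
by rewrite -e m'f in mf.
Qed.

(** A homogeneous sequence that is regular modulo x, where x is itself
regular, is regular without reducing modulo x, and x is regular after it. If f
h is in J with h homogeneous, then h = x h' modulo J with h' of smaller degree
and f h' in J, so h is in J by induction on its degree. *)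
Lemma graded_regular_lift J x fs : is_ideal J -> graded J ->
  x \is 1.-homog -> regular_mod J x ->
  (forall f, f \in fs -> exists e, f \is e.-homog) ->
  weakly_regular (adjoin J x) fs ->
  weakly_regular J fs /\ regular_mod (adjoin_seq J fs) x.
Proof.
elim: fs J => [|f fs IH] J hJ gJ hx rx hfs //= [rf rfs].
have [e hf] := hfs f (mem_head _ _).
have rJf : regular_mod J f.
  have homog_case d : forall h, h \is d.-homog -> J (f * h) -> J h.
    elim: d => [|d IHd] h hh fh; have [a Ja] := rf h (sub_adjoin _ fh).
      have := gJ _ 0%N Ja; rewrite pihomogB (pihomogM_homog _ _ hx) /= subr0.
      by rewrite pihomog_dE.
    have := gJ _ d.+1 Ja; rewrite pihomogB (pihomogM_homog _ _ hx) /= subn1 /=.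
    rewrite (pihomog_dE hh) => Ja'.
    have Jhca : J (hc d a).
      apply: IHd; first exact: pihomogP.
      apply: rx; have -> : x * (f * hc d a) = f * h - f * (h - hc d a * x) by ring.
      by apply: idealB => //; apply: idealM.
    have -> : h = (h - hc d a * x) + x * hc d a by ring.
    by apply: idealD => //; apply: idealM.
  move=> h fh; rewrite (pihomog_partitionE (leqnn (mmeasure mdeg h))).
  elim/big_rec: _ => [|d y _ Jy]; first exact: ideal0.
  apply: idealD => //; apply: (homog_case d); first exact: pihomogP.
  have := gJ _ (d + e)%N fh; rewrite mulrC (pihomogM_homog _ _ hf).
  by rewrite leq_addl addnK mulrC.
have [] := IH (adjoin J f).
- exact: adjoin_ideal.
- exact: graded_adjoin hf.
- exact: hx.
- exact: regular_adjoin.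
- by move=> g gin; apply: hfs; rewrite inE gin orbT.
- by apply: weakly_regular_iff rfs => y; split; apply: adjoin_swap.
- by [].
Qed.

Definition var_ideal Z : S -> Prop := mon_ideal (fun A => ~~ [disjoint A & Z]).

Lemma upward_meet Z : upward (fun A => ~~ [disjoint A & Z]).
Proof. by move=> A B AB; apply: contraNN => /(disjointWl AB). Qed.

Lemma mon_ideal_eq N N' : (forall A, N A = N' A) ->
  forall f, mon_ideal N f <-> mon_ideal N' f.
Proof. by move=> e f; split=> H m /H; rewrite e. Qed.

Lemma disjoint_insert i A Z : [disjoint i |: A & Z] = (i \notin Z) && [disjoint A & Z].
Proof. by rewrite disjoints_subset subUset sub1set inE -disjoints_subset. Qed.

Definition esyms t : seq S := [seq mesym n K i | i <- iota 1 t].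

Lemma esymsS t : esyms t.+1 = rcons (esyms t) (mesym n K t.+1).
Proof. by rewrite /esyms -[t.+1 in LHS]addn1 iotaD map_cat /= cats1. Qed.

Lemma prod_varsE A : \prod_(i in A) 'X_i = 'X_[mesym1 A] :> S.
Proof.
rewrite mpolyXE_id [LHS]big_mkcond /=; apply: eq_bigr => i _; rewrite mnmE.
by case: (i \in A).
Qed.

(** In m variables e_m is the product of the variables; here m variables are
left modulo those of Z. *)
Lemma mesym_top Z : var_ideal Z (mesym n K (n - #|Z|) - \prod_(i in ~: Z) 'X_i).
Proof.
rewrite prod_varsE mesymE (bigD1 (~: Z)) /=; last by rewrite cardsCs setCK card_ord.
rewrite [X in var_ideal _ (X - _)]addrC addrK => m /msupp_sum_le /flattenP [s /mapP [A]].
rewrite mem_filter => /andP[/andP[/eqP cA ne] _] ->; rewrite msuppX inE => /eqP ->.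
rewrite mnm_supp_mesym1; apply: contraNN ne; rewrite disjoints_subset => AZ.
by rewrite eqEcard AZ cA cardsCs setCK card_ord leqnn.
Qed.

(** The induction adds a variable to Z. The elements below the top one are
handled by [graded_regular_lift], applied to every remaining variable; so each
variable, hence their product e_m, is regular modulo the earlier ones. *)
Lemma esyms_regular_vars Z : weakly_regular (var_ideal Z) (esyms (n - #|Z|)).
Proof.
have hI Z' := mon_ideal_ideal K (@upward_meet Z') : is_ideal (var_ideal Z').
elim: (n - #|Z|)%N {-2}Z (erefl (n - #|Z|)%N) => {Z} [|t IH] Z cZ; first by rewrite cZ.
rewrite cZ esymsS; apply/weakly_regular_rcons.
have lift i : i \notin Z -> weakly_regular (var_ideal Z) (esyms t) /\
    regular_mod (adjoin_seq (var_ideal Z) (esyms t)) 'X_i.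
  move=> iZ; apply: graded_regular_lift.
  - exact: hI.
  - exact: graded_mon_ideal.
  - by rewrite dhomogX; apply/eqP/mdeg1.
  - move=> h /mon_ideal_colon H; apply/mon_ideal_eq/H => A /=.
    by rewrite disjoint_insert iZ.
  - move=> f /mapP [d _ ->]; exists d; apply/dhomogP => m.
    by rewrite msupp_mesymP => /existsP [A /andP[/eqP <- /eqP ->]]; apply: mdeg_mesym1.
  - have := IH (i |: Z); rewrite cardsU1 iZ => H.
    have e : (n - (1 + #|Z|) = t)%N by lia.
    rewrite e in H; apply: weakly_regular_iff (H erefl) => f.
    rewrite (mon_ideal_adjoin _ _ (@upward_meet Z)); apply: mon_ideal_eq => A /=.
    by rewrite disjoint_sym disjoint_insert negb_and negbK orbC disjoint_sym.
have [i iZ] : exists i, i \in ~: Z.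
  by apply/set0Pn; rewrite -card_gt0 cardsCs setCK card_ord cZ.
rewrite inE in iZ; split; first by case: (lift i iZ).
have hP : regular_mod (adjoin_seq (var_ideal Z) (esyms t)) (\prod_(j in ~: Z) 'X_j).
  by apply: regular_mod_prod => j; rewrite inE => /lift [].
have hA := adjoin_seq_ideal (esyms t) (hI Z).
move=> h th; apply: hP; rewrite -cZ in th.
set P := \prod_(j in _) _.
have -> : P * h = mesym n K (n - #|Z|) * h - h * (mesym n K (n - #|Z|) - P) by ring.
apply: idealB => //; apply: idealM => //; apply: sub_adjoin_seq; exact: mesym_top.
Qed.

Lemma esyms_prefix J t t' : (t <= t')%N -> weakly_regular J (esyms t') ->
  weakly_regular J (esyms t).
Proof.
move=> le; rewrite /esyms -(subnKC le) iotaD map_cat.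
by case/weakly_regular_cat.
Qed.

Lemma weakly_regular_total J fs : (forall f, J f) -> weakly_regular J fs.
Proof.
elim: fs J => //= f fs IH J tot; split=> [h _|]; first exact: tot.
by apply: IH => g; apply: sub_adjoin.
Qed.

(** The ideal is (I : x_U) + (x_z : z in Z). A vertex outside Z and U is added
to Z by deletion and to U by link. The recursion stops once Z leaves only t
vertices: these form a face whatever U is, so the ideal is the prime of Z. If
no vertex is left before that, U is the complement of Z and the ideal is the
unit ideal if U is a nonface, and the prime of Z otherwise. *)
Lemma esyms_regular_link N t Z U : upward N -> (forall A, N A -> (t < #|A|)%N) ->
  [disjoint U & Z] -> (t + #|Z| <= n)%N ->
  weakly_regular (mon_ideal (fun A => ~~ [disjoint A & Z] || N (A :|: U))) (esyms t).
Proof.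
move=> up Nt; move e: #|~: (Z :|: U)| => w.
elim: w Z U e => [|w IH] Z U cW dUZ.
  have UZ : ~: Z \subset U.
    apply/subsetP => i; rewrite inE => iZ.
    have := cards0_eq cW => /setP /(_ i); rewrite !inE negb_or iZ /=.
    by move/negbFE.
  move=> le; case: (boolP (N U)) => NU.
    by apply: weakly_regular_total => f m _; rewrite (up _ _ _ NU) ?orbT // subsetUr.
  apply: (@esyms_prefix _ _ (n - #|Z|)%N); first by lia.
  apply: weakly_regular_iff (esyms_regular_vars Z) => f; apply: mon_ideal_eq => A /=.
  case: (boolP [disjoint A & Z]) => //=; rewrite disjoints_subset => AZ.
  by rewrite (setUidPr _) ?(negbTE NU) // (subset_trans AZ).
rewrite leq_eqVlt => /orP [/eqP e|lt].
  (* Exactly t vertices are left. *)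
  have -> : t = (n - #|Z|)%N by lia.
  apply: weakly_regular_iff (esyms_regular_vars Z) => f; apply: mon_ideal_eq => A /=.
  case: (boolP [disjoint A & Z]) => //= AZ; apply/esym/negbTE/negP => /Nt.
  have : (#|A :|: U| <= #|~: Z|)%N.
    by apply: subset_leq_card; rewrite subUset -!disjoints_subset AZ dUZ.
  by rewrite [#|~: Z|]cardsCs setCK card_ord; lia.
have [i] : exists i, i \in ~: (Z :|: U) by apply/set0Pn; rewrite -card_gt0 cW.
rewrite !inE negb_or => /andP[iZ iU].
have upI : upward (fun A => ~~ [disjoint A & Z] || N (A :|: U)).
  move=> A B AB /orP [/(upward_meet AB) -> //|NA].
  by rewrite (up _ _ _ NA) ?orbT // setSU.
have cW' X : X = i |: (Z :|: U) -> #|~: X| = w.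
  move=> ->; have := cardsC (Z :|: U); have := cardsC (i |: (Z :|: U)).
  by rewrite cardsU1 !inE negb_or iZ iU cW; lia.
apply: (@weakly_regular_extension _ _ 'X_i); first exact: mon_ideal_ideal.
  have := IH (i |: Z) U; rewrite -setUA => /(_ (cW' _ erefl)).
  rewrite disjoint_sym disjoint_insert iU disjoint_sym cardsU1 iZ => /(_ dUZ) H.
  have {}H := H ltac:(lia).
  apply: weakly_regular_iff H => f; rewrite mon_ideal_adjoin //.
  apply: mon_ideal_eq => A; rewrite disjoint_sym disjoint_insert negb_and negbK disjoint_sym.
  by case: (i \in A); rewrite ?orbT ?orbF.
have := IH Z (i |: U); rewrite setUCA => /(_ (cW' _ erefl)).
rewrite disjoint_insert iZ => /(_ dUZ (ltnW lt)) H.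
apply: weakly_regular_iff H => f; rewrite mon_ideal_colon.
by apply: mon_ideal_eq => A; rewrite disjoint_insert iZ setUCA setUA.
Qed.

Lemma esyms_regular N t : upward N -> (forall A, N A -> (t < #|A|)%N) ->
  (t <= n)%N -> weakly_regular (mon_ideal N) (esyms t).
Proof.
move=> up Nt le.
have := @esyms_regular_link N t set0 set0 up Nt.
rewrite disjoints_subset sub0set cards0 addn0 => /(_ isT le).
apply: weakly_regular_iff => f; apply: mon_ideal_eq => A /=.
by rewrite disjoint_sym disjoints_subset sub0set setU0.
Qed.

Lemma mesym_coef0 t f : f \in esyms t -> f@_0%MM = 0.
Proof.
case/mapP=> d; rewrite mem_iota => /andP[d0 _] ->; apply/eqP; rewrite mcoeff_eq0.
apply/negP; rewrite msupp_mesymP => /existsP [A /andP[/eqP cA /eqP e]].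
by have := mdeg_mesym1 A; rewrite -e mdeg0 cA; lia.
Qed.

(** The facet D is of the least size that the hypothesis on nonfaces allows,
so the two bounds on the depth meet. *)
Theorem mon_ideal_depth N D : upward N -> (forall A, N A -> (#|D| < #|A|)%N) ->
  (forall v, v \notin D -> N (v |: D)) ->
  is_depth_quotient (mon_ideal N : S -> Prop) #|D|.
Proof.
move=> up Nt facet; have hI := mon_ideal_ideal K up.
have ND : ~~ N D by apply/negP => /Nt; rewrite ltnn.
have tn : (#|D| <= n)%N by rewrite -[n in (_ <= n)%N]card_ord max_card.
split.
  exists (esyms #|D|); split.
  - by rewrite size_map size_iota.
  - by move=> f /mesym_coef0 f0; apply/irrelevant_idealE.
  - apply/regular_sequenceE => //; split; first exact: esyms_regular.
    move=> H; have : @irrelevant_ideal K n 1.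
      apply: adjoin_seq_min H; first exact: ideal_gen_ideal.
        move=> f If; apply/irrelevant_idealE/eqP; rewrite mcoeff_eq0.
        apply/negP => /If /Nt; suff -> : mnm_supp (0%MM : 'X_{1..n}) = set0 by rewrite cards0.
        by apply/setP => i; rewrite !inE mnm0E.
      by move=> f /mesym_coef0 /irrelevant_idealE.
    by move/irrelevant_idealE/eqP; rewrite mcoeff1 eqxx oner_eq0.
move=> fs fsm /regular_sequenceE [] // rs _.
by apply: regular_length_le up ND facet _ rs => f /fsm /irrelevant_idealE.
Qed.

Lemma depth_quotientE J d : is_depth_quotient J d -> depth_quotient J = d.
Proof.
move=> hd; have [[fs' [sz' m' r']] max'] : is_depth_quotient J (depth_quotient J).
  by apply: (epsilon_spec (inhabits 0%N) (is_depth_quotient J)); exists d.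
have [[fs [sz m r]] max] := hd.
by apply/eqP; rewrite eqn_leq -{1}sz' max // -{1}sz max'.
Qed.

Lemma is_depth_quotient_iff J J' d : (forall f, J f <-> J' f) -> is_ideal J ->
  is_ideal J' -> is_depth_quotient J d -> is_depth_quotient J' d.
Proof.
move=> e hJ hJ'.
have E fs : regular_sequence J fs <-> regular_sequence J' fs.
  have e' f : J' f <-> J f by split=> /e.
  rewrite !regular_sequenceE // (adjoin_seq_iff _ e).
  by split=> -[rs ?]; split=> //; apply: weakly_regular_iff rs.
move=> [[fs [sz hm /E r]] max]; split; first by exists fs.
by move=> gs gm /E gr; apply: max.
Qed.

End LowerBound.

(** * Matchings in a dominating clique *)

Section Matchings.
Variables (n : nat) (e : rel 'I_n).
Implicit Types (A D : {set 'I_n}) (M : {set {set 'I_n}}).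

Definition covers_matching k A : bool :=
  [exists M : {set {set 'I_n}}, [&& is_matching e M, #|M| == k & cover M \subset A]].

Lemma edgesP A : reflect (exists i j, e i j /\ A = [set i; j]) (A \in edges e).
Proof.
rewrite /edges inE; apply: (iffP existsP) => [[i /existsP [j /andP[eij /eqP ->]]]|].
  by exists i, j.
by move=> [i [j [eij ->]]]; exists i; apply/existsP; exists j; rewrite eij eqxx.
Qed.

Lemma covers_matchingP k A :
  reflect (exists M, [/\ is_matching e M, #|M| = k & cover M \subset A])
    (covers_matching k A).
Proof.
apply: (iffP existsP) => [[M /and3P[mM /eqP cM sM]]|[M [mM cM sM]]]; exists M => //.
by rewrite mM cM eqxx.
Qed.

Lemma upward_covers_matching k : upward (covers_matching k).
Proof.
move=> A B AB /covers_matchingP [M [mM cM sM]]; apply/covers_matchingP.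
by exists M; split=> //; apply: subset_trans AB.
Qed.

Lemma card_cover_matching M : irreflexive e -> is_matching e M -> #|cover M| = 2 * #|M|.
Proof.
move=> e_irr /andP[/subsetP Me /eqP <-]; rewrite mulnC -sum_nat_const.
apply: eq_bigr => A /Me /edgesP [i [j [eij ->]]].
by rewrite cards2; case: eqP eij => // ->; rewrite e_irr.
Qed.

Lemma covers_matching_card k A : irreflexive e -> covers_matching k A -> 2 * k <= #|A|.
Proof.
move=> e_irr /covers_matchingP [M [mM <- /subset_leq_card]].
by rewrite card_cover_matching.
Qed.

Lemma covers_matching_edge k A u v : e u v -> u \notin A -> v \notin A ->
  covers_matching k A -> covers_matching k.+1 (u |: (v |: A)).
Proof.
move=> euv uA vA /covers_matchingP [M [mM cM sM]]; apply/covers_matchingP.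
have /andP[/subsetP Me tM] := mM.
have disj : {in M, forall B : {set 'I_n}, [disjoint [set u; v] & B]}.
  move=> B BM; have BA : B \subset A by apply: subset_trans sM; apply: bigcup_sup.
  rewrite disjoints_subset; apply/subsetP => w; rewrite !inE => /orP [] /eqP ->.
    by apply: contra uA; apply: (subsetP BA).
  by apply: contra vA; apply: (subsetP BA).
have M0 : set0 \notin M.
  apply/negP => /Me /edgesP [i [j [_ /setP /(_ i)]]].
  by rewrite !inE eqxx.
have [tM' uvM] := trivIsetU1 disj tM M0.
exists ([set u; v] |: M); split.
- rewrite /is_matching tM' andbT; apply/subsetP => B; rewrite in_setU1 => /orP [/eqP ->|/Me //].
  by apply/edgesP; exists u, v.
- by rewrite cardsU1 uvM cM.
- by rewrite /cover bigcup_setU big_set1 setUA setUSS.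
Qed.

(** Any two vertices of a clique form an edge, so the vertices can be paired
off arbitrarily. *)
Lemma clique_covers_matching D : is_clique e D ->
  forall j A, A \subset D -> 2 * j <= #|A| -> covers_matching j A.
Proof.
move=> cl; elim=> [|j IH] A AD cA.
  apply/covers_matchingP; exists set0; split; rewrite ?cards0 //.
    rewrite /is_matching sub0set; apply/trivIsetP => B C; by rewrite inE.
  by rewrite /cover big_set0 sub0set.
have /card_gt0P [u uA] : 0 < #|A| by lia.
have cu := cardsD1 u A; rewrite uA in cu.
have /card_gt0P [v vA] : 0 < #|A :\ u| by lia.
have cv := cardsD1 v (A :\ u); rewrite vA in cv.
have := vA; rewrite !inE => /andP[vu vA'].
rewrite -(setD1K uA) -(setD1K vA).
apply: covers_matching_edge; rewrite ?inE ?eqxx ?andbF //.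
  by apply: cl; rewrite ?(subsetP AD) // eq_sym.
apply: IH; last by lia.
by rewrite (subset_trans _ AD) // (subset_trans (subsetDl _ _)) ?subsetDl.
Qed.

(** An edge vu with u in D leaves the 2k - 2 vertices of the clique D minus u,
which are paired off. *)
Lemma dominating_clique_covers_matching k D v : 0 < k -> #|D| = 2 * k - 1 ->
  is_clique e D -> is_dominating e D -> v \notin D -> covers_matching k (v |: D).
Proof.
move=> k0 cD cl dom vD; have [u uD evu] := dom _ vD.
have cu := cardsD1 u D; rewrite uD in cu.
rewrite -(setD1K uD); case: k k0 cD => // k _ cD.
apply: covers_matching_edge => //; rewrite ?inE ?eqxx ?(negbTE vD) ?andbF //.
apply: (clique_covers_matching cl); first exact: subsetDl.
by lia.
Qed.

End Matchings.

Section SquarefreePower.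
Import GRing.Theory.
Local Open Scope ring_scope.
Variables (K : fieldType) (n : nat) (e : rel 'I_n).
Local Notation S := {mpoly K[n]}.

Lemma matching_monomialE (M : {set {set 'I_n}}) : trivIset M ->
  \prod_(A in M) \prod_(i in A) 'X_i = 'X_[mesym1 (cover M)] :> S.
Proof. by move=> tM; rewrite -prod_varsE big_trivIset. Qed.

Lemma squarefree_powerE k (f : S) :
  squarefree_power K e k f <-> mon_ideal (covers_matching e k) f.
Proof.
have up := @upward_covers_matching _ e k.
split.
  apply: ideal_gen_min; first exact: mon_ideal_ideal.
  move=> g [M [mM cM ->]]; rewrite matching_monomialE; last by case/andP: mM.
  apply: mon_idealX; rewrite mnm_supp_mesym1.
  by apply/covers_matchingP; exists M.
have hI : is_ideal (squarefree_power K e k) by apply: ideal_gen_ideal.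
apply: mon_ideal_min => // m /covers_matchingP [M [mM cM sM]].
rewrite -(submK (mesym1_leP sM)) mpolyXD; apply: idealM => //.
apply: ideal_gen_mem; exists M; split=> //.
by rewrite matching_monomialE //; case/andP: mM.
Qed.

End SquarefreePower.

Theorem theorem2p7 (K : fieldType) (n : nat) (e : rel 'I_n)
    (e_sym : symmetric e) (e_irr : irreflexive e)
    (k : nat) (k_ge2 : 2 <= k) (k_le_nu : k <= matching_number e)
    (D : {set 'I_n}) (D_card : #|D| = 2 * k - 1)
    (D_clique : is_clique e D) (D_dom : is_dominating e D) :
  normalized_depth K e k = 0%R.
Proof.
have k0 : 0 < k by apply: ltnW.
have hI := mon_ideal_ideal K (@upward_covers_matching _ e k).
have hd : is_depth_quotient (squarefree_power K e k) (2 * k - 1).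
  apply: (@is_depth_quotient_iff _ _ (mon_ideal (covers_matching e k))) => //.
  - by move=> f; rewrite squarefree_powerE.
  - exact: ideal_gen_ideal.
  rewrite -D_card; apply: mon_ideal_depth.
  - exact: upward_covers_matching.
  - by move=> A /(covers_matching_card e_irr); rewrite D_card; lia.
  - by move=> v vD; apply: dominating_clique_covers_matching vD.
rewrite /normalized_depth (depth_quotientE hd).
lia.
Qed.
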